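(* Let $f:\mathbb{N}\to\mathbb{N}$ be a function such that for all positive natural numbers $x,y$ there exist natural numbers $a,b$ with $\gcd(a,f(y))=1$ and $$f(x+y)=a\cdot f(x)+b\cdot f(y).$$ Then $f$ distributes over the greatest common divisor on positive arguments: for all positive natural numbers $m,n$, $$f(\gcd(m,n))=\gcd(f(m),f(n)).$$
   Context: $\mathbb{N}$ denotes the natural numbers including $0$. The greatest common divisor is taken with respect to the divisibility ordering on $\mathbb{N}$, i.e. $\gcd(m,n)$ is the unique natural number such that, for all $k\in\mathbb{N}$, $k\mid m$ and $k\mid n$ if and only if $k\mid \gcd(m,n)$; in particular $\gcd(m,0)=m$ and $\gcd(0,0)=0$. *)

(* Defs.v *)
From mathcomp Require Export all_boot.

(* Main.v *)
(** Since [a] is coprime to [f y], [gcd (f (x + y)) (f y) = gcd (f x) (f y)], so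
    [gcd (f m) (f n)] is invariant under the steps of the subtractive Euclidean
    algorithm on [(m, n)], which keeps both arguments positive and ends at
    [(gcd m n, gcd m n)]. *)
Require Import Defs.
From mathcomp Require Import all_boot.

(** Neither adding a multiple of [v] nor a factor coprime to [v] affects a gcd with [v]. *)
Lemma gcdn_comb_coprime (a b u v : nat) :
  coprime a v -> gcdn (a * u + b * v) v = gcdn u v.
Proof.
by move=> cav; rewrite gcdnC addnC gcdnMDl Gauss_gcdr 1?coprime_sym // gcdnC.
Qed.

(** Strong induction on [m + n]: for unequal arguments, subtracting the smaller from the larger
    keeps both positive and lowers the sum, the smaller being positive. *)
Lemma gcdn_subtractive_ind (P : nat -> nat -> Prop) :
  (forall n, 0 < n -> P n n) ->
  (forall m n, P m n -> P n m) ->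
  (forall m n, 0 < m -> 0 < n -> P m n -> P (m + n) n) ->
  forall m n, 0 < m -> 0 < n -> P m n.
Proof.
move=> Pdiag Psym Padd m n; have [k] := ubnP (m + n).
elim: k m n => // k IHk m n; rewrite ltnS => le_mn_k m_gt0 n_gt0.
(* Equal arguments fall to [Pdiag]; otherwise [Psym] lets the larger come first. *)
wlog lt_nm: m n le_mn_k m_gt0 n_gt0 / n < m => [IH|].
  case: (ltngtP m n) => [lt_mn | lt_nm | ->]; last exact: Pdiag.
    by apply: Psym; apply: IH; rewrite // addnC.
  exact: IH.
rewrite -(subnK (ltnW lt_nm)); apply: Padd; rewrite ?subn_gt0 //.
apply: IHk; rewrite ?subn_gt0 // (subnK (ltnW lt_nm)).
by apply: leq_trans le_mn_k; rewrite -[ltnLHS]addn0 ltn_add2l.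
Qed.

Theorem lemma24 (f : nat -> nat)
    (hf : forall x y : nat, 0 < x -> 0 < y ->
      exists a b : nat, gcdn a (f y) = 1 /\ f (x + y) = a * f x + b * f y) :
  forall m n : nat, 0 < m -> 0 < n -> f (gcdn m n) = gcdn (f m) (f n).
Proof.
apply: gcdn_subtractive_ind => [n _ | m n IH | m n m_gt0 n_gt0 IH].
- by rewrite !gcdnn.
- by rewrite gcdnC IH gcdnC.
have [a [b [/eqP cafn ->]]] := hf m n m_gt0 n_gt0.
by rewrite gcdn_comb_coprime // -IH gcdnC gcdnDr gcdnC.
Qed.
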